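(* Let $C$ be a normal, closed cone with nonempty interior in a real Banach space. Let $f:\operatorname{int} C\to\operatorname{int} C$ be $d_T$-nonexpansive and either $\gamma$-condensing or $\tau$-condensing. If $f$ has a fixed point in $\operatorname{int} C$, then for any $0<\alpha<1$ and any $x_0\in\operatorname{int} C$, the sequence defined by $x_{n+1}=\alpha f(x_n)+(1-\alpha)x_n$ converges to a fixed point of $f$.
   Context: A closed cone $C$ (closed convex, $\lambda C\subseteq C$ for $\lambda\ge0$, $C\cap(-C)=\{0\}$) induces the order $x\le y$ iff $y-x\in C$. $C$ is normal if there is $\kappa$ with $\|x\|\le\kappa\|y\|$ whenever $0\le x\le y$. Thompson's metric on $\operatorname{int}C$: $d_T(x,y)=\log\inf\{\beta\ge1:\beta^{-1}x\le y\le\beta x\}$; $f$ is $d_T$-nonexpansive if $d_T(f(x),f(y))\le d_T(x,y)$. For norm-bounded $A$, $\gamma(A)=\inf\{d>0: A$ has a finite cover by sets of norm diameter $\le d\}$; for $d_T$-bounded $A\subseteq\operatorname{int}C$, $\tau(A)$ is defined likewise with $d_T$-diameter. A continuous map $f$ is $\gamma$-condensing (resp. $\tau$-condensing) if $\gamma(f(A))<\gamma(A)$ for every bounded $A$ in its domain with $\gamma(A)>0$ (resp. $\tau(f(A))<\tau(A)$ for every $d_T$-bounded $A$ with $\tau(A)>0$). *)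

(* Defs.v *)
From mathcomp Require Import all_boot all_order all_algebra.
From mathcomp Require Import all_classical all_reals all_analysis.
Set Implicit Arguments. Unset Strict Implicit. Unset Printing Implicit Defensive.
Import Order.TTheory GRing.Theory Num.Theory.
Import numFieldNormedType.Exports.
Local Open Scope classical_set_scope.
Local Open Scope ring_scope.

Section ConeDefs.
Variables (R : realType) (V : completeNormedModType R).

Definition is_closed_cone (C : set V) : Prop :=
  [/\ closed C,
      (forall x y (t : R), C x -> C y -> 0 <= t -> t <= 1 -> C (t *: x + (1 - t) *: y)),
      (forall (l : R) x, 0 <= l -> C x -> C (l *: x))
    & (forall x, C x -> C (- x) -> x = 0)].

Definition cone_le (C : set V) (x y : V) : Prop := C (y - x).

Definition normal_cone (C : set V) : Prop :=
  exists kappa : R, forall x y, cone_le C 0 x -> cone_le C x y -> `|x| <= kappa * `|y|.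

Definition thompson_set (C : set V) (x y : V) : set R :=
  [set b : R | 1 <= b /\ cone_le C (b^-1 *: x) y /\ cone_le C y (b *: x)].

Definition dT (C : set V) (x y : V) : R := ln (inf (thompson_set C x y)).

Definition dT_nonexpansive (C : set V) (f : V -> V) : Prop :=
  forall x y, C° x -> C° y -> dT C (f x) (f y) <= dT C x y.

Definition norm_cover (A : set V) (d : R) : Prop :=
  exists (n : nat) (S : nat -> set V),
    A `<=` \bigcup_(i in `I_n) S i /\
    (forall i, (i < n)%N -> forall x y, S i x -> S i y -> `|x - y| <= d).

Definition dT_cover (C : set V) (A : set V) (d : R) : Prop :=
  exists (n : nat) (S : nat -> set V),
    A `<=` \bigcup_(i in `I_n) S i /\
    (forall i, (i < n)%N -> S i `<=` C° /\
        forall x y, S i x -> S i y -> dT C x y <= d).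

(* Kuratowski measures of noncompactness (extended-real valued; +oo if no cover) *)
Definition gamma_nc (A : set V) : \bar R :=
  ereal_inf [set (d%:E)%E | d in [set d : R | 0 < d /\ norm_cover A d]].

Definition tau_nc (C : set V) (A : set V) : \bar R :=
  ereal_inf [set (d%:E)%E | d in [set d : R | 0 < d /\ dT_cover C A d]].

Definition norm_bounded (A : set V) : Prop :=
  exists M : R, forall x, A x -> `|x| <= M.

Definition dT_bounded (C : set V) (A : set V) : Prop :=
  exists M : R, forall x y, A x -> A y -> dT C x y <= M.

Definition gamma_condensing (C : set V) (f : V -> V) : Prop :=
  {within C°, continuous f} /\
  forall A : set V, A `<=` C° -> norm_bounded A -> (0 < gamma_nc A)%E ->
    (gamma_nc (f @` A) < gamma_nc A)%E.

Definition tau_condensing (C : set V) (f : V -> V) : Prop :=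
  {within C°, continuous f} /\
  forall A : set V, A `<=` C° -> dT_bounded C A -> (0 < tau_nc C A)%E ->
    (tau_nc C (f @` A) < tau_nc C A)%E.

End ConeDefs.

(* Main.v *)
Require Import Defs.
From mathcomp Require Import all_boot all_order all_algebra.
From mathcomp Require Import all_classical all_reals all_analysis.
From mathcomp Require Import ring lra.
Import Order.TTheory GRing.Theory Num.Theory.
Import numFieldNormedType.Exports.
Local Open Scope classical_set_scope.
Local Open Scope ring_scope.

(** Write [thompson_eqv C b x y] for [b^-1 x <= y <= b x]; nonexpansiveness says
    that [f], hence the averaged map [F = alpha f + (1 - alpha) id], preserves
    each of these relations.
    - Asymptotic regularity: if [x_(n+1) <= b x_n] along the orbit, the slacks
      [z_n = b x_n - x_(n+1)] satisfy [z_(n+1) >= (1 - alpha) z_n].  Summing,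
      [b^(m+1) x_n - x_(n+m+1)] is a weighted sum of slacks, so it is at most a
      constant times [z_(n+m)].  The orbit is [d_T]-bounded, so for [b > 1] and
      [m] large this forces [z_(n+m) >= eps x_(n+m)] with [eps] uniform in [b]:
      the constant [b] can be improved, and its infimum along the orbit is 1.
    - Compactness: the orbit [A] is [{x_0}] together with [F(A)].  Combining
      covers of [A] and [f(A)] gives a cover of [A] by sets strictly smaller
      than its measure of noncompactness, which is therefore zero.
    - A cluster point [q] then satisfies [F q = q], and as [d_T(x_n, q)] is
      nonincreasing the whole sequence converges to [q]. *)

Set Implicit Arguments.
Unset Strict Implicit.

(** * Linear identities in modules *)

(** Syntax for proof by reflection: both sides of a module identity are reified over one list of
    atoms, and agreement of their scalar coefficients suffices. *)
Inductive lin_expr (R : Type) :=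
  | LVar of nat | LZero | LAdd of lin_expr R & lin_expr R
  | LOpp of lin_expr R | LScale of R & lin_expr R.
Arguments LVar {R}. Arguments LZero {R}.
Arguments LAdd {R}. Arguments LOpp {R}. Arguments LScale {R}.

Fixpoint lin_eval {R : comNzRingType} {V : lmodType R} (vs : seq V)
    (e : lin_expr R) : V :=
  match e with
  | LVar n => nth 0 vs n
  | LZero => 0
  | LAdd a b => lin_eval vs a + lin_eval vs b
  | LOpp a => - lin_eval vs a
  | LScale k a => k *: lin_eval vs a
  end.

(** The test uses [eqn] so that [cbn] evaluates it on closed indices. *)
Fixpoint lin_coef {R : comNzRingType} (e : lin_expr R) (i : nat) : R :=
  match e with
  | LVar n => if eqn n i then 1 else 0
  | LZero => 0
  | LAdd a b => lin_coef a i + lin_coef b i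
  | LOpp a => - lin_coef a i
  | LScale k a => k * lin_coef a i
  end.

Fixpoint lin_agree {R : comNzRingType} (n : nat) (e1 e2 : lin_expr R) : Prop :=
  match n with
  | 0%N => True
  | n'.+1 => lin_coef e1 n' = lin_coef e2 n' /\ lin_agree n' e1 e2
  end.

Lemma lin_evalE (R : comNzRingType) (V : lmodType R) (vs : seq V) e :
  lin_eval vs e = \sum_(i < size vs) lin_coef e i *: nth 0 vs i.
Proof.
elim: e => [n||a iha b ihb|a iha|k a iha] /=.
- have [ltn|gen] := ltnP n (size vs); last first.
    rewrite nth_default// big1// => i _.
    case: eqnP => [ni|_]; last by rewrite scale0r.
    by move: (ltn_ord i); rewrite -ni ltnNge gen.
  rewrite (bigD1 (Ordinal ltn))//= eqnE eqxx scale1r big1 ?addr0// => i /eqP nei.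
  case: (n =P i :> nat) => [ni|_]; last by rewrite scale0r.
  by case: nei; apply: val_inj; rewrite /= ni.
- by rewrite big1// => i _; rewrite scale0r.
- by rewrite iha ihb -big_split; apply: eq_bigr => i _; rewrite scalerDl.
- by rewrite iha -sumrN; apply: eq_bigr => i _; rewrite scaleNr.
- by rewrite iha scaler_sumr; apply: eq_bigr => i _; rewrite scalerA.
Qed.

Lemma lin_agree_eval (R : comNzRingType) (V : lmodType R) (vs : seq V) e1 e2 :
  lin_agree (size vs) e1 e2 -> lin_eval vs e1 = lin_eval vs e2.
Proof.
rewrite !lin_evalE; elim: (size vs) => [|n ih] /=; first by rewrite !big_ord0.
by move=> [e12 /ih]; rewrite !big_ord_recr /= e12 => ->.
Qed.

Ltac lin_insert v vs :=
  lazymatch vs with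
  | context [v :: _] => vs
  | _ => constr:(v :: vs)
  end.
Ltac lin_atoms t vs :=
  lazymatch t with
  | (?a + ?b)%R => let vs := lin_atoms a vs in lin_atoms b vs
  | (- ?a)%R => lin_atoms a vs
  | (_ *: ?a)%R => lin_atoms a vs
  | 0%R => vs
  | _ => lin_insert t vs
  end.
Ltac lin_index v vs :=
  lazymatch vs with
  | v :: _ => constr:(0%N)
  | _ :: ?vs' => let n := lin_index v vs' in constr:(S n)
  end.
Ltac lin_reify t vs :=
  lazymatch t with
  | (?a + ?b)%R =>
      let a' := lin_reify a vs in let b' := lin_reify b vs in
      uconstr:(LAdd a' b')
  | (- ?a)%R => let a' := lin_reify a vs in uconstr:(LOpp a')
  | (?k *: ?a)%R => let a' := lin_reify a vs in uconstr:(LScale k a')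
  | 0%R => uconstr:(LZero)
  | _ => let n := lin_index t vs in uconstr:(LVar n)
  end.
(* Linear identities in a module: [ring] (or [field]) compares the coefficients
   of each vector. *)
Ltac lin_coefs :=
  lazymatch goal with
  | |- @eq ?V ?a ?b =>
      let vs := lin_atoms a constr:(@nil V) in
      let vs := lin_atoms b vs in
      let a' := lin_reify a vs in
      let b' := lin_reify b vs in
      refine (@lin_agree_eval _ _ vs a' b' _);
      cbn [size lin_agree lin_coef eqn];
      repeat match goal with |- _ /\ _ => split | |- True => exact I end
  end.
Ltac module := lin_coefs; ring.
Ltac field_module := lin_coefs; field; try done.

(** * The order relation behind Thompson's metric *)

Section Cone.
Variables (R : realType) (V : completeNormedModType R) (C : set V).
Hypothesis coneC : is_closed_cone C.

Lemma cone_scale l x : 0 <= l -> C x -> C (l *: x).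
Proof. by case: coneC => _ _ + _; apply. Qed.

Lemma cone_add x y : C x -> C y -> C (x + y).
Proof.
move=> Cx Cy; have [_ cvxC _ _] := coneC.
have -> : x + y = 2 *: (2^-1 *: x + (1 - 2^-1) *: y) by field_module.
by apply: cone_scale => //; apply: cvxC => //; lra.
Qed.

Lemma cone_antisym x y : C (x - y) -> C (y - x) -> x = y.
Proof.
case: coneC => _ _ _ pt Cxy Cyx; apply/eqP; rewrite -subr_eq0; apply/eqP.
by apply: pt => //; rewrite opprB.
Qed.

Lemma cone_closed x y : (forall e, 0 < e -> C (x + e *: y)) -> C x.
Proof.
case: coneC => + _ _ _ Cxy; apply; move=> B /nbhs_normP[r /= r0 rB].
have y1 : 0 < `|y| + 1 by rewrite ltr_wpDl.
exists (x + (r / 2 / (`|y| + 1)) *: y); split.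
  by apply: Cxy; rewrite !divr_gt0.
apply: rB; rewrite /= opprD addNKr normrN normrZ ger0_norm ?divr_ge0 ?ltW//.
by rewrite mulrAC ltr_pdivrMr// mulrDr mulr1 -subr_gt0; nra.
Qed.

(** Closed balls admit vectors rescaled to norm exactly [r], as the decompositions below require. *)
Lemma coneIntP x :
  C° x <-> exists2 r : R, 0 < r & forall v, `|v| <= r -> C (x + v).
Proof.
split=> [/nbhs_normP[r /= r0 rC]|[r r0 rC]].
  exists (r / 2); first by rewrite divr_gt0.
  move=> v vr; apply: rC; rewrite /= opprD addNKr normrN.
  by apply: le_lt_trans vr _; lra.
apply/nbhs_normP; exists r => //= y xy; rewrite -(subrKC x y).
by apply: rC; rewrite distrC ltW.
Qed.

Lemma coneIntW x : C° x -> C x.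
Proof. exact: interior_subset. Qed.

Lemma coneInt_add x y : C° x -> C y -> C° (x + y).
Proof.
move=> /coneIntP[r r0 rC] Cy; apply/coneIntP; exists r => // v vr.
by rewrite addrAC; apply: cone_add => //; exact: rC.
Qed.

Lemma coneInt_scale t x : 0 < t -> C° x -> C° (t *: x).
Proof.
move=> t0 /coneIntP[r r0 rC]; apply/coneIntP; exists (t * r).
  by rewrite mulr_gt0.
move=> v vr; have -> : t *: x + v = t *: (x + t^-1 *: v).
  by field_module; rewrite gt_eqF.
apply: cone_scale (ltW t0) _; apply: rC.
rewrite normrZ ger0_norm; last by rewrite invr_ge0 ltW.
by rewrite mulrC ler_pdivrMr// mulrC.
Qed.

(** A small multiple of [- y] keeps [x] inside its ball in the cone; rescaling gives the claim. *)
Lemma coneInt_absorb x y : C° x -> exists2 M : R, 0 < M & C (M *: x - y).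
Proof.
move=> /coneIntP[r r0 rC]; have y1 : 0 < `|y| + 1 by rewrite ltr_wpDl.
exists ((`|y| + 1) / r); first by rewrite divr_gt0.
have -> : ((`|y| + 1) / r) *: x - y =
    ((`|y| + 1) / r) *: (x + (- (r / (`|y| + 1))) *: y).
  by field_module; rewrite ?gt_eqF.
apply: cone_scale; first by rewrite divr_ge0// ltW.
apply: rC; rewrite normrZ normrN ger0_norm; last by rewrite divr_ge0// ltW.
by rewrite mulrAC ler_pdivrMr// ler_pM2l//; lra.
Qed.

(** Free of inverses, so that such relations combine by linear identities with nonnegative
    coefficients. *)
Definition thompson_eqv (b : R) (x y : V) : Prop :=
  C (b *: x - y) /\ C (b *: y - x).

Lemma thompson_eqv_sym b x y : thompson_eqv b x y -> thompson_eqv b y x.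
Proof. by case. Qed.

Lemma thompson_eqv_le b c x y : C x -> C y -> b <= c ->
  thompson_eqv b x y -> thompson_eqv c x y.
Proof.
move=> Cx Cy bc [xy yx]; have cb : 0 <= c - b by rewrite subr_ge0.
split.
  have -> : c *: x - y = (b *: x - y) + (c - b) *: x by module.
  by apply: cone_add => //; exact: cone_scale.
have -> : c *: y - x = (b *: y - x) + (c - b) *: y by module.
by apply: cone_add => //; exact: cone_scale.
Qed.

Lemma thompson_eqv_trans b c x y z : 0 <= b -> 0 <= c ->
  thompson_eqv b x y -> thompson_eqv c y z -> thompson_eqv (b * c) x z.
Proof.
move=> b0 c0 [xy yx] [yz zy]; split.
  have -> : (b * c) *: x - z = c *: (b *: x - y) + (c *: y - z) by module.
  by apply: cone_add => //; exact: cone_scale.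
have -> : (b * c) *: z - x = b *: (c *: z - y) + (b *: y - x) by module.
by apply: cone_add => //; exact: cone_scale.
Qed.

Lemma thompson_eqv_closed b x y :
  (forall c, b < c -> thompson_eqv c x y) -> thompson_eqv b x y.
Proof.
move=> bxy; split.
  apply: (@cone_closed _ x) => e e0.
  have -> : b *: x - y + e *: x = (b + e) *: x - y by module.
  by apply: (bxy _ _).1; rewrite ltrDl.
apply: (@cone_closed _ y) => e e0.
have -> : b *: y - x + e *: y = (b + e) *: y - x by module.
by apply: (bxy _ _).2; rewrite ltrDl.
Qed.

Lemma thompson_eqv1 x y : thompson_eqv 1 x y -> x = y.
Proof. by move=> [] /[!scale1r]; exact: cone_antisym. Qed.

Lemma thompson_eqv_ex x y : C° x -> C° y -> exists2 b : R, 1 <= b & thompson_eqv b x y.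
Proof.
move=> Ix Iy; have [M M0 xy] := @coneInt_absorb x y Ix.
have [N N0 yx] := @coneInt_absorb y x Iy.
exists (1 + M + N); first by lra.
have N1 : 0 <= 1 + N by lra.
have M1 : 0 <= 1 + M by lra.
have [Cx Cy] := (coneIntW Ix, coneIntW Iy).
split.
  have -> : (1 + M + N) *: x - y = (M *: x - y) + (1 + N) *: x by module.
  by apply: cone_add => //; exact: cone_scale.
have -> : (1 + M + N) *: y - x = (N *: y - x) + (1 + M) *: y by module.
by apply: cone_add => //; exact: cone_scale.
Qed.

Lemma thompson_setE b x y : 1 <= b ->
  thompson_set C x y b <-> thompson_eqv b x y.
Proof.
move=> b1; have b0 : b != 0 by rewrite gt_eqF//; lra.
split=> [[_ [yx xy]]|[xy yx]].
  split=> //; have -> : b *: y - x = b *: (y - b^-1 *: x).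
    by field_module.
  by apply: cone_scale => //; lra.
split=> //; split=> //; rewrite /cone_le.
have -> : y - b^-1 *: x = b^-1 *: (b *: y - x) by field_module.
by apply: cone_scale => //; rewrite invr_ge0; lra.
Qed.

(** Since the cone is closed, the infimum defining [dT] is itself an admissible ratio; metric bounds
    thus become order relations. *)
Lemma dT_le_lnP b x y : C° x -> C° y -> 1 <= b ->
  dT C x y <= ln b <-> thompson_eqv b x y.
Proof.
move=> Ix Iy b1; have [Cx Cy] := (coneIntW Ix, coneIntW Iy).
have lb1 : lbound (thompson_set C x y) 1 by move=> c [].
have hlb : has_lbound (thompson_set C x y) by exists 1.
have ne : thompson_set C x y !=set0.
  by have [c c1 cxy] := thompson_eqv_ex Ix Iy; exists c; apply/thompson_setE.
have i1 : 1 <= inf (thompson_set C x y) by exact: lb_le_inf.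
rewrite /dT ler_ln ?posrE; [|lra..].
split=> [ib|bxy]; last by apply: ge_inf => //; apply/thompson_setE.
apply: (thompson_eqv_le Cx Cy ib); apply: thompson_eqv_closed => c ic.
have [|d dxy dc] := @inf_adherent _ _ (c - inf (thompson_set C x y)) _ (conj ne hlb).
  by rewrite subr_gt0.
have d1 : 1 <= d by exact: lb1.
move: dxy => /(thompson_setE _ _ d1); apply: thompson_eqv_le => //; lra.
Qed.

Lemma dT_le_thompson_eqv d x y : C° x -> C° y -> 0 <= d ->
  dT C x y <= d <-> thompson_eqv (expR d) x y.
Proof.
by move=> Ix Iy d0; rewrite -{1}(expRK d) dT_le_lnP// -expR0 ler_expR.
Qed.

(** In [x - y = (b - 1) *: y - (b *: y - x)] the last term lies between 0 and [(b - b^-1) *: y], so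
    normality bounds it; moreover [b - b^-1 <= 2 * (b - 1)]. *)
Lemma normal_dist_le : normal_cone C -> exists2 c : R, 0 < c &
  forall b x y, 1 <= b -> C y -> thompson_eqv b x y ->
  `|x - y| <= c * (b - 1) * `|y|.
Proof.
move=> [k kC]; exists (2 * `|k| + 1); first by have := normr_ge0 k; lra.
move=> b x y b1 Cy [xy yx]; have b0 : 0 < b by lra.
have bV : 0 < b^-1 by rewrite invr_gt0.
have bbV : b * b^-1 = 1 by rewrite divff// gt_eqF.
have h : `|b *: y - x| <= k * `|(b - b^-1) *: y|.
  apply: kC; rewrite /cone_le ?subr0//.
  have -> : (b - b^-1) *: y - (b *: y - x) = b^-1 *: (b *: x - y).
    by field_module; rewrite gt_eqF.
  by apply: cone_scale => //; exact: ltW.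
have -> : x - y = (b - 1) *: y - (b *: y - x) by module.
rewrite (le_trans (ler_normB _ _))//.
have b2 : 0 <= b - b^-1 <= 2 * (b - 1) by nra.
rewrite normrZ (ger0_norm (_ : 0 <= b - 1)); last by lra.
have {}h : `|b *: y - x| <= `|k| * (2 * (b - 1)) * `|y|.
  apply: le_trans h _; rewrite normrZ ger0_norm; last by lra.
  apply: (@le_trans _ _ (`|k| * ((b - b^-1) * `|y|))).
    by apply: ler_wpM2r (ler_norm _); rewrite mulr_ge0//; lra.
  by rewrite -mulrA ler_wpM2l// ler_wpM2r//; lra.
by apply: le_trans (lerD (lexx _) h) _; rewrite le_eqVlt; apply/orP; left; apply/eqP; ring.
Qed.

(** Points above [K^-1 *: p] are uniformly interior: a ball around [p] inside the cone absorbs small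
    displacements, with a constant depending only on [p] and [K]. *)
Lemma thompson_eqv_of_dist K p : C° p -> 0 < K -> exists2 c : R, 0 < c &
  forall x y d, C (K *: x - p) -> C (K *: y - p) -> 0 <= d -> `|x - y| <= d ->
  thompson_eqv (1 + c * d) x y.
Proof.
move=> /coneIntP[r r0 rC] K0; exists (K / r); first by rewrite divr_gt0.
have main x y d : C (K *: x - p) -> 0 <= d -> `|x - y| <= d ->
    C ((1 + K / r * d) *: x - y).
  (* The case [d = 0] is separate because the decomposition divides by [d]. *)
  move=> xp; rewrite le_eqVlt => /orP[/eqP <-|d0 xyd].
    rewrite normr_le0 subr_eq0 => /eqP <-.
    rewrite mulr0 addr0 scale1r subrr -(scale0r (K *: x - p)).
    by apply: cone_scale.
  have -> : (1 + K / r * d) *: x - y =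
      (d / r) *: (K *: x - p) + (d / r) *: (p + (r / d) *: (x - y)).
    by field_module; rewrite ?gt_eqF.
  have dr : 0 <= d / r by rewrite divr_ge0// ltW.
  apply: cone_add; apply: cone_scale => //; apply: rC.
  rewrite normrZ ger0_norm; last by rewrite divr_ge0// ltW.
  by rewrite mulrAC ler_pdivrMr// ler_wpM2l// ltW.
move=> x y d xp yp d0 xyd; split; first exact: main.
by apply: main => //; rewrite distrC.
Qed.

End Cone.

(** * Averaged iterations *)

(** Bernoulli's inequality; the successor exponent matches [mann_telescope]. *)
Lemma expr_unbounded (R : realType) (b M : R) : 1 < b ->
  exists n : nat, M <= b ^+ n.+1.
Proof.
move=> b1; have h0 : 0 < b - 1 by rewrite subr_gt0.
have bern n : 1 + n%:R * (b - 1) <= b ^+ n.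
  elim: n => [|n ih]; first by rewrite mul0r addr0 expr0.
  rewrite exprS -natr1; have b0 : 0 <= b by lra.
  have : 0 <= n%:R * (b - 1) ^+ 2 by rewrite mulr_ge0// sqr_ge0.
  by have := ler_wpM2l b0 ih; rewrite expr2; lra.
exists (Num.bound `|M / (b - 1)|); apply: le_trans (bern _).
have : M / (b - 1) < (Num.bound `|M / (b - 1)|)%:R.
  exact: le_lt_trans (ler_norm _) (archi_boundP (normr_ge0 _)).
by rewrite ltr_pdivrMr// -natr1; lra.
Qed.

Section Mann.
Variables (R : realType) (V : completeNormedModType R) (C : set V) (f : V -> V).
Hypothesis coneC : is_closed_cone C.
Hypothesis f_int : forall x, C° x -> C° (f x).
Hypothesis f_eqv : forall b x y, 1 <= b -> C° x -> C° y ->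
  thompson_eqv C b x y -> thompson_eqv C b (f x) (f y).
Variable alpha : R.
Hypotheses (alpha0 : 0 < alpha) (alpha1 : alpha < 1).

Let a_ge0 : 0 <= alpha. Proof. exact: ltW. Qed.
Let a1_gt0 : 0 < 1 - alpha. Proof. by rewrite subr_gt0. Qed.
Let a1_ge0 : 0 <= 1 - alpha. Proof. exact: ltW. Qed.

Definition mann_map (x : V) : V := alpha *: f x + (1 - alpha) *: x.

Lemma mann_map_int x : C° x -> C° (mann_map x).
Proof.
move=> Ix; apply: (coneInt_add coneC); first exact/coneInt_scale/f_int.
by apply: cone_scale => //; exact: coneIntW.
Qed.

Lemma mann_map_eqv b x y : 1 <= b -> C° x -> C° y ->
  thompson_eqv C b x y -> thompson_eqv C b (mann_map x) (mann_map y).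
Proof.
move=> b1 Ix Iy xy; have [fxy fyx] := f_eqv b1 Ix Iy xy.
move: xy => [xy yx]; rewrite /mann_map; split.
  have -> : b *: (alpha *: f x + (1 - alpha) *: x) -
      (alpha *: f y + (1 - alpha) *: y) =
      alpha *: (b *: f x - f y) + (1 - alpha) *: (b *: x - y) by module.
  by apply: cone_add => //; exact: cone_scale.
have -> : b *: (alpha *: f y + (1 - alpha) *: y) -
      (alpha *: f x + (1 - alpha) *: x) =
    alpha *: (b *: f y - f x) + (1 - alpha) *: (b *: y - x) by module.
by apply: cone_add => //; exact: cone_scale.
Qed.

Variable x : nat -> V.
Hypothesis x0_int : C° (x 0%N).
Hypothesis xS : forall n, x n.+1 = mann_map (x n).

Lemma mann_int n : C° (x n).
Proof. by elim: n => // n ih; rewrite xS; exact: mann_map_int. Qed.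

Lemma mann_cone n : C (x n).
Proof. by apply: coneIntW; exact: mann_int. Qed.

Lemma mann_step_eqv b n k : 1 <= b -> thompson_eqv C b (x n) (x n.+1) ->
  thompson_eqv C b (x (n + k)) (x (n + k).+1).
Proof.
move=> b1 xn; elim: k => [|k ih]; first by rewrite addn0.
by rewrite addnS xS [x _.+2]xS; apply: mann_map_eqv => //; exact: mann_int.
Qed.

(** Fejér monotonicity: [p] is fixed by the averaged map too, which preserves the relation. *)
Lemma mann_fix_eqv b p n k : 1 <= b -> C° p -> f p = p ->
  thompson_eqv C b (x n) p -> thompson_eqv C b (x (n + k)) p.
Proof.
move=> b1 Ip fp xnp; have Fp : mann_map p = p by rewrite /mann_map fp; module.
elim: k => [|k ih]; first by rewrite addn0.
by rewrite addnS xS -Fp; apply: mann_map_eqv => //; exact: mann_int.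
Qed.

(* Weights of the slacks in the telescoping sums of [mann_telescope]; [B] is an
   upper bound for the ratio [b], making the constant independent of [b]. *)
Fixpoint regularity_const (B : R) (m : nat) : R :=
  if m is m'.+1 then
    B ^+ m + B * regularity_const B m' / (1 - alpha)
  else 1.

Lemma regularity_const_ge1 B m : 1 <= B -> 1 <= regularity_const B m.
Proof.
move=> B1; elim: m => // m ih /=; rewrite ler_wpDr ?exprn_ege1//.
by rewrite divr_ge0// mulr_ge0//; lra.
Qed.

Lemma mann_telescope B b n m : 1 <= b -> b <= B ->
  thompson_eqv C b (x n) (x n.+1) ->
  C (regularity_const B m *: (b *: x (n + m) - x (n + m).+1) -
     (b ^+ m.+1 *: x n - x (n + m).+1)) /\
  C (regularity_const B m *: (b *: x (n + m).+1 - x (n + m)) -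
     (b ^+ m.+1 *: x (n + m).+1 - x n)).
Proof.
move=> b1 bB xn; have b0 : 0 <= b by lra.
have B1 : 1 <= B by lra.
elim: m => [|m [ih1 ih2]].
  rewrite addn0 expr1 !scale1r !subrr.
  by split; rewrite -(scale0r (x n)); apply: cone_scale => //; exact: mann_cone.
have [] := mann_step_eqv m b1 xn.
have [] := f_eqv b1 (mann_int _) (mann_int _) (mann_step_eqv m b1 xn).
have [] := mann_step_eqv m.+1 b1 xn.
rewrite addnS; have := xS (n + m); have := xS (n + m).+1; rewrite /mann_map.
move: (x (n + m).+2) (x (n + m).+1) (f (x (n + m).+1)) (f (x (n + m))) ih1 ih2.
move: (x (n + m)) (x n) => y y0 y2 y1 fy1 fy ih1 ih2 y2E y1E C1 C2 C3 C4 C5 C6.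
have := regularity_const_ge1 m B1; rewrite /=.
move: (regularity_const B m) ih1 ih2 => c ih1 ih2 c1.
have ca0 : 0 <= c / (1 - alpha) by rewrite divr_ge0//; lra.
have bm : 1 <= b ^+ m.+1 by rewrite exprn_ege1.
have bBm : b ^+ m.+1 <= B ^+ m.+1 by rewrite lerXn2r// nnegrE; lra.
have cB : b * (c / (1 - alpha)) <= B * c / (1 - alpha).
  by rewrite -mulrA ler_wpM2r.
have cB' : c / (1 - alpha) <= B * c / (1 - alpha).
  by rewrite -mulrA ler_peMl.
have a1n : 1 - alpha != 0 by rewrite gt_eqF.
rewrite (exprS b m.+1); move: (b ^+ m.+1) (B ^+ m.+1) bm bBm ih1 ih2.
move=> e E bm bBm ih1 ih2.
(* A new slack dominates [1 - alpha] times the old one: the difference is a slack of [f],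
   nonnegative by nonexpansiveness. *)
have D1 : C ((b *: y1 - y2) - (1 - alpha) *: (b *: y - y1)).
  have -> : (b *: y1 - y2) - (1 - alpha) *: (b *: y - y1) =
      alpha *: (b *: fy - fy1) by rewrite y2E y1E; module.
  exact: cone_scale.
have D2 : C ((b *: y2 - y1) - (1 - alpha) *: (b *: y1 - y)).
  have -> : (b *: y2 - y1) - (1 - alpha) *: (b *: y1 - y) =
      alpha *: (b *: fy1 - fy) by rewrite y2E y1E; module.
  exact: cone_scale.
(* The new sum is [b] times the old one plus the fresh slack; by [D1] the old slack costs at most
   [(1 - alpha)^-1] fresh ones. *)
split.
  have -> : (E + B * c / (1 - alpha)) *: (b *: y1 - y2) - ((b * e) *: y0 - y2) =
      b *: (c *: (b *: y - y1) - (e *: y0 - y1)) +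
      ((E + B * c / (1 - alpha) - 1 - b * (c / (1 - alpha))) *: (b *: y1 - y2) +
      (b * (c / (1 - alpha))) *:
        ((b *: y1 - y2) - (1 - alpha) *: (b *: y - y1))) by field_module.
  apply: cone_add => //; first exact: cone_scale.
  apply: cone_add => //; apply: cone_scale => //; last exact: mulr_ge0.
  by lra.
(* Here the fresh slack has weight [e], which the summand [E] of the constant covers. *)
have -> : (E + B * c / (1 - alpha)) *: (b *: y2 - y1) - ((b * e) *: y2 - y0) =
    (c *: (b *: y1 - y) - (e *: y1 - y0)) +
    ((E + B * c / (1 - alpha) - e - c / (1 - alpha)) *: (b *: y2 - y1) +
    (c / (1 - alpha)) *:
      ((b *: y2 - y1) - (1 - alpha) *: (b *: y1 - y))) by field_module.
apply: cone_add => //.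
apply: cone_add => //; apply: cone_scale => //.
by lra.
Qed.

Variable K : R.
Hypothesis K1 : 1 <= K.
Hypothesis xK : forall n m, thompson_eqv C K (x n) (x m).

Lemma mann_step_improve B0 B : 1 < B0 -> B0 <= B ->
  exists (m : nat) (e : R), 0 < e /\ forall b n, B0 <= b -> b <= B ->
    thompson_eqv C b (x n) (x n.+1) ->
    thompson_eqv C (b - e) (x (n + m)) (x (n + m).+1).
Proof.
move=> B01 B0B; have K_ge1 := K1; have [m mK] := expr_unbounded (K + 1) B01.
have B1 : 1 <= B by lra.
(* As [b ^+ m.+1 >= K + 1], the telescoped sum dominates [x n], hence [K^-1 *: x (n + m)]; the slack
   is at least this sum divided by the constant. *)
exists m, (regularity_const B m * K)^-1.
have := regularity_const_ge1 m B1 => c1.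
have cK : 0 < regularity_const B m * K
  by rewrite mulr_gt0 ?(lt_le_trans ltr01 c1) ?(lt_le_trans ltr01 K1).
split; first by rewrite invr_gt0.
move=> b n B0b bB xn; have b1 : 1 <= b by lra.
have [] := mann_telescope m b1 bB xn.
move: (regularity_const B m) c1 cK => c c1 cK.
have {}mK : K + 1 <= b ^+ m.+1.
  by apply: le_trans mK _; rewrite lerXn2r// nnegrE; lra.
have cK0 : 0 <= (c * K)^-1 by rewrite invr_ge0 ltW.
have cn : c != 0 by rewrite gt_eqF//; lra.
have Kn : K != 0 by rewrite gt_eqF//; lra.
have K0 : 0 <= K by lra.
have [] := xK n (n + m); have [] := xK n (n + m).+1.
have := mann_cone n; have := mann_cone (n + m).+1.
move: (b ^+ m.+1) mK (x n) (x (n + m)) (x (n + m).+1).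
move=> e eK y0 y y1 Cy1 Cy0 y01 y10 y0y yy0 D1 D2; split.
  have -> : (b - (c * K)^-1) *: y - y1 = (c * K)^-1 *:
     (K *: (c *: (b *: y - y1) - (e *: y0 - y1)) +
     ((K * (e - (K + 1))) *: y0 + (K *: (K *: y0 - y1) + (K *: y0 - y)))).
    by field_module; rewrite cn Kn.
  apply: cone_scale => //; apply: cone_add => //; first exact: cone_scale.
  apply: cone_add => //; first by apply: cone_scale => //; rewrite mulr_ge0//; lra.
  by apply: cone_add => //; exact: cone_scale.
have -> : (b - (c * K)^-1) *: y1 - y = (c * K)^-1 *:
   (K *: (c *: (b *: y1 - y) - (e *: y1 - y0)) +
   ((K * (e - (K + 1)) + (K - 1)) *: y1 + K *: (K *: y1 - y0))).
  by field_module; rewrite cn Kn.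
apply: cone_scale => //; apply: cone_add => //; first exact: cone_scale.
apply: cone_add => //; last exact: cone_scale.
by apply: cone_scale => //; rewrite addr_ge0// ?mulr_ge0//; lra.
Qed.

Lemma mann_asymptotic_regular b : 1 < b -> exists N : nat,
  forall n, (N <= n)%N -> thompson_eqv C b (x n) (x n.+1).
Proof.
move=> b1; pose S := [set c : R | 1 <= c /\ exists n, thompson_eqv C c (x n) (x n.+1)].
have SK : S K by split=> //; exists 0%N.
have lS : has_lbound S by exists 1 => c [].
have hS : has_inf S by split=> //; exists K.
have i1 : 1 <= inf S by apply: lb_le_inf => [|c []//]; exists K.
suff [c [c1 [n xn]] cb] : exists2 c, S c & c < b.
  exists n => k nk; rewrite -(subnKC nk).
  apply: (thompson_eqv_le coneC _ _ (ltW cb)); try exact: mann_cone.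
  exact: mann_step_eqv.
have [ib|bi] := ltP (inf S) b.
  have [|c Sc cb] := @inf_adherent _ S (b - inf S) _ hS; first by rewrite subr_gt0.
  by exists c => //; lra.
have i1' : 1 < inf S by exact: lt_le_trans bi.
(* One gain [e] serves all ratios in [[inf S, inf S + 1]]; a ratio [c] within [Num.min e 1] of the
   infimum lies there, and [c - e] falls below [inf S]. *)
have [|m [e [e0 me]]] := @mann_step_improve (inf S) (inf S + 1) i1'; first by lra.
have [|c [c1 [n xn]] ci] := @inf_adherent _ S (Num.min e 1) _ hS.
  by rewrite lt_min e0 ltr01.
have ic : inf S <= c by apply: ge_inf => //; split=> //; exists n.
have mine : Num.min e 1 <= e by rewrite ge_min lexx.
have min1 : Num.min e 1 <= 1 by rewrite ge_min lexx orbT.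
have {me}xnm : thompson_eqv C (c - e) (x (n + m)) (x (n + m).+1).
  by apply: me => //; lra.
(* Members of [S] are at least 1, hence the maximum; both arguments are below [inf S]. *)
have : S (Num.max 1 (c - e)).
  split; first by rewrite le_max lexx.
  exists (n + m)%N; apply: (thompson_eqv_le coneC _ _ _ xnm); try exact: mann_cone.
  by rewrite le_max lexx orbT.
by move=> /(ge_inf lS); rewrite le_max => /orP[]; lra.
Qed.

End Mann.

(** * Finite covers and compactness of the orbit *)

Section FiniteCover.
Variables (R : realType) (V : completeNormedModType R).
Implicit Types (A B S T : set V) (Q : set V -> Prop).

(** Common form of [norm_cover] and [dT_cover], so that covers are combined once for both. *)
Definition fin_cover Q A : Prop :=
  exists (n : nat) (S : nat -> set V),
    A `<=` \bigcup_(i in `I_n) S i /\ (forall i, (i < n)%N -> Q (S i)).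

Lemma norm_coverE A d : norm_cover A d =
  fin_cover (fun S => forall x y, S x -> S y -> `|x - y| <= d) A.
Proof. by []. Qed.

Lemma dT_coverE (C A : set V) d : dT_cover C A d =
  fin_cover (fun S => S `<=` C° /\
    forall x y, S x -> S y -> dT C x y <= d) A.
Proof. by []. Qed.

Lemma fin_cover_refl Q A : Q A -> fin_cover Q A.
Proof. by move=> QA; exists 1%N, (fun=> A); split => // a Aa; exists 0%N. Qed.

Lemma fin_cover_setU1 Q A B z :
  Q [set z] -> B `<=` z |` A -> fin_cover Q A -> fin_cover Q B.
Proof.
move=> Qz BA [n [S [AS SQ]]].
exists n.+1, (fun k => if k is k'.+1 then S k' else [set z]).
split=> [b /BA[->|/AS[i /= ni Sib]]|[|i] //= ni]; last exact: SQ.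
  by exists 0%N.
by exists i.+1.
Qed.

(** Pairs of pieces are indexed by quotient and remainder modulo [m]. Pieces are cut down to [A] and
    [B] because [mann_op_eqv] needs a comparability known only there. *)
Lemma fin_cover_image2 Q1 Q2 Q A B (op : V -> V -> V) :
  fin_cover Q1 A -> fin_cover Q2 B ->
  (forall S T, Q1 S -> Q2 T ->
    Q [set op u v | u in A `&` S & v in B `&` T]) ->
  fin_cover Q [set op u v | u in A & v in B].
Proof.
move=> [n [S [AS SQ]]] [m [T [BT TQ]]] QST.
exists (n * m)%N, (fun k => [set op u v | u in A `&` S (k %/ m)%N &
                                     v in B `&` T (k %% m)%N]).
split.
  move=> _ [u Au [v Bv <-]]; have [i /= ni Siu] := AS _ Au.
  have [j /= mj Tjv] := BT _ Bv; exists (i * m + j)%N => /=.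
    apply: (@leq_trans (i.+1 * m)); first by rewrite mulSn addnC ltn_add2r.
    by rewrite leq_mul2r ni orbT.
  have m0 : (0 < m)%N by exact: leq_ltn_trans mj.
  rewrite divnMDl// divn_small// addn0 modnMDl modn_small//.
  by exists u => //; exists v.
move=> k nmk; have m0 : (0 < m)%N by case: (m) nmk => //; rewrite muln0.
by apply: QST; [apply: SQ; rewrite ltn_divLR|apply: TQ; rewrite ltn_mod].
Qed.

(** An ultrafilter containing all tails picks one piece of each finite cover, so it is Cauchy; its
    limit is the cluster point. *)
Lemma totally_bounded_cluster (x : nat -> V) :
  (forall e : R, 0 < e -> norm_cover (range x) e) ->
  exists q, forall (e : R) N, 0 < e -> exists2 n, (N <= n)%N & `|x n - q| < e.
Proof.
move=> xcov; have [G [GU xG]] := ultraFilterLemma (fmap_proper_filter x eventually_filter).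
have Gx : G (range x) by apply: xG; exists 0%N => // n _; exists n.
have Gcup n (S : nat -> set V) :
    G (\bigcup_(i in `I_n) S i) -> exists2 i, (i < n)%N & G (S i).
  elim: n => [|n ih] GS.
    by have [y [i]] := filter_ex GS.
  have [GSn|GSn] := in_ultra_setVsetC (S n) GU; first by exists n.
  have [|i ni GSi] := ih; last by exists i => //; exact: ltnW.
  apply: filterS (filterI GS GSn) => y [[i /= ni Siy] nSy].
  exists i => //=; move: ni; rewrite ltnS leq_eqVlt => /orP[/eqP ein|//].
  by case: nSy; rewrite -ein.
have /cauchy_cvgP Gcvg : cauchy G.
  apply: cauchy_exP => e e0; have [|n [S [xS Sd]]] := xcov (e / 2).
    by rewrite divr_gt0.
  have [i ni GSi] := Gcup _ _ (filterS xS Gx).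
  have [y Siy] := filter_ex GSi; exists y; apply: filterS GSi => z Siz.
  rewrite -ball_normE /ball_ /=; apply: le_lt_trans (Sd _ ni _ _ Siy Siz) _; lra.
exists (lim G) => e N e0.
have Gball : G (ball (lim G) e) by apply: Gcvg; exact: nbhsx_ballx.
have Gtail : G [set x n | n in [set n | (N <= n)%N]].
  by apply: xG; exists N => // n /= Nn; exists n.
have [y [By [n /= Nn xny]]] := filter_ex (filterI Gball Gtail).
by move: By; rewrite -xny -ball_normE /ball_ /= distrC => xn; exists n.
Qed.

End FiniteCover.

(** [P] and [Q] say which diameters suffice to cover the orbit and its image. If the orbit had
    measure [t > 0], the image would have a cover with [s < t], and [step] would cover the orbit
    below [t]. *)
Lemma condensing_vanish (R : realType) (P Q : R -> Prop) :
  let nc P := ereal_inf [set (d%:E)%E | d in [set d : R | 0 < d /\ P d]] in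
  (exists2 d, 0 < d & P d) ->
  (forall d d', P d -> d <= d' -> P d') ->
  ((0 < nc P)%E -> (nc Q < nc P)%E) ->
  (forall s t, 0 < s -> s < t -> Q s -> (forall u, t < u -> P u) ->
    exists d, [/\ 0 < d, d < t & P d]) ->
  forall e, 0 < e -> P e.
Proof.
move=> nc [d0 d00 Pd0] Pmono PQ step e e0.
have ncP u : (nc P < u%:E)%E -> P u.
  by move=> /ereal_inf_lt[_ [d [_ Pd] <-]]; rewrite lte_fin => /ltW; exact: Pmono.
have ncPle d : 0 < d -> P d -> (nc P <= d%:E)%E.
  by move=> ? ?; apply: ereal_inf_lbound; exists d.
have [P0|/PQ] := leP (nc P) 0%E; first by apply: ncP; apply: le_lt_trans P0 _; rewrite lte_fin.
have := ncPle _ d00 Pd0; case E : (nc P) => [t| |]//; last by move=> _; rewrite ltNge leNye.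
move=> _ /ereal_inf_lt[_ [s [s0 Qs] <-]]; rewrite lte_fin => st.
have [|d [dpos dt Pd]] := step s t s0 st Qs.
  by move=> u tu; apply: ncP; rewrite E lte_fin.
by have := ncPle _ dpos Pd; rewrite E lee_fin leNgt dt.
Qed.

(** * Covers of the orbit from covers of its image *)

Section Convergence.
Variables (R : realType) (V : completeNormedModType R) (C : set V) (f : V -> V).
Hypothesis coneC : is_closed_cone C.
Variable alpha : R.
Hypotheses (alpha0 : 0 < alpha) (alpha1 : alpha < 1).
Variable x : nat -> V.
Hypothesis x0_int : C° (x 0%N).
Hypothesis xS : forall n, x n.+1 = mann_map f alpha (x n).

Let mann_op (u v : V) : V := alpha *: u + (1 - alpha) *: v.

(** The pairing of [f (x n)] with [x n] is forgotten, so the two factors can be covered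
    independently. *)
Let orbitE : range x `<=`
  x 0%N |` [set mann_op u v | u in f @` range x & v in range x].
Proof.
move=> _ [[|n] _ <-]; first by left.
by right; exists (f (x n)); [exists (x n)|exists (x n); rewrite // xS].
Qed.

Lemma norm_cover_orbit s t : 0 < s -> s < t -> norm_cover (f @` range x) s ->
  (forall u, t < u -> norm_cover (range x) u) ->
  exists d, [/\ 0 < d, d < t & norm_cover (range x) d].
Proof.
move=> s0 st fs tu; have [a0 a1] := (alpha0, alpha1).
(* Orbit covers exist only above [t]; this excess gives [d = t - alpha ^+ 2 * (t - s)]. *)
pose u := t + alpha * (t - s).
have tu' : t < u by rewrite ltrDl mulr_gt0// subr_gt0.
pose d := alpha * s + (1 - alpha) * u.
have d0 : 0 < d.
  by rewrite addr_gt0// mulr_gt0//; lra.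
exists d; split => //.
  have : 0 < alpha ^+ 2 * (t - s) by rewrite mulr_gt0 ?exprn_gt0// subr_gt0.
  by rewrite /d /u expr2; lra.
rewrite norm_coverE; apply: (fin_cover_setU1 _ orbitE).
  by move=> y z -> ->; rewrite subrr normr0 ltW.
rewrite norm_coverE in fs; have := tu u tu'; rewrite norm_coverE => {}tu.
apply: (fin_cover_image2 fs tu) => S T Ss Tu.
move=> _ _ [v [_ Sv] [w [_ Tw] <-]] [v' [_ Sv'] [w' [_ Tw'] <-]].
have -> : mann_op v w - mann_op v' w' =
    alpha *: (v - v') + (1 - alpha) *: (w - w') by rewrite /mann_op; module.
apply: le_trans (ler_normD _ _) _; rewrite !normrZ !ger0_norm; [|lra..].
by apply: lerD; (apply: ler_wpM2l; first lra); [exact: Ss|exact: Tu].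
Qed.

(* Comparability of [u] and [v] lets the slack in [u] absorb the excess in [v],
   so the ratio is a proper average of [S] and [T] instead of their maximum. *)
Lemma mann_op_eqv K S T u v u' v' : 0 <= K -> S <= T ->
  let l := alpha / (alpha + (1 - alpha) * K) in
  C (K *: u - v) -> C (K *: u' - v') ->
  thompson_eqv C S u u' -> thompson_eqv C T v v' ->
  thompson_eqv C (l * S + (1 - l) * T) (mann_op u v) (mann_op u' v').
Proof.
move=> K0 ST l Kuv Kuv' [uu' u'u] [vv' v'v]; have [a0 a1] := (alpha0, alpha1).
have aK : 0 < alpha + (1 - alpha) * K by rewrite ltr_pwDl// mulr_ge0//; lra.
(* The weight [l] solves [alpha * (1 - l) = (1 - alpha) * l * K], so surplus in [u] and deficit in
   [v] combine into a multiple of [K *: u - v]. *)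
have c0 : 0 <= (1 - alpha) * (alpha / (alpha + (1 - alpha) * K)) * (T - S).
  by rewrite !mulr_ge0 ?subr_ge0 ?invr_ge0// ltW.
have aKn : alpha + (1 - alpha) * K != 0 by rewrite gt_eqF.
rewrite /mann_op /l; split.
  have -> : (alpha / (alpha + (1 - alpha) * K) * S +
      (1 - alpha / (alpha + (1 - alpha) * K)) * T) *:
      (alpha *: u + (1 - alpha) *: v) - (alpha *: u' + (1 - alpha) *: v') =
    alpha *: (S *: u - u') + ((1 - alpha) *: (T *: v - v') +
    ((1 - alpha) * (alpha / (alpha + (1 - alpha) * K)) * (T - S)) *:
      (K *: u - v)) by field_module.
  by apply: cone_add => //; [|apply: cone_add => //]; apply: cone_scale => //; lra.
have -> : (alpha / (alpha + (1 - alpha) * K) * S +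
    (1 - alpha / (alpha + (1 - alpha) * K)) * T) *:
    (alpha *: u' + (1 - alpha) *: v') - (alpha *: u + (1 - alpha) *: v) =
  alpha *: (S *: u' - u) + ((1 - alpha) *: (T *: v' - v) +
  ((1 - alpha) * (alpha / (alpha + (1 - alpha) * K)) * (T - S)) *:
    (K *: u' - v')) by field_module.
by apply: cone_add => //; [|apply: cone_add => //]; apply: cone_scale => //; lra.
Qed.

Lemma dT_cover_orbit K : 0 <= K -> (forall n m, C (K *: f (x n) - x m)) ->
  forall s t, 0 < s -> s < t -> dT_cover C (f @` range x) s ->
  (forall u, t < u -> dT_cover C (range x) u) ->
  exists d, [/\ 0 < d, d < t & dT_cover C (range x) d].
Proof.
move=> K0 fK s t s0 st fs tu; have [a0 a1] := (alpha0, alpha1).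
pose l := alpha / (alpha + (1 - alpha) * K).
have aK0 : 0 <= (1 - alpha) * K by rewrite mulr_ge0// subr_ge0 ltW.
have l0 : 0 < l by rewrite divr_gt0// ltr_pwDl.
have l1 : l <= 1 by rewrite ler_pdivrMr ?ltr_pwDl// mul1r lerDl.
have S1 : 1 < expR s by rewrite expR_gt1.
have ST : expR s < expR t by rewrite ltr_expR.
(* The same choice for ratios, with [l] as weight: [L = expR t - l ^+ 2 * (expR t - expR s)]. *)
pose T := expR t + l * (expR t - expR s).
have tT : expR t < T by rewrite ltrDl mulr_gt0// subr_gt0.
have T0 : 0 < T by lra.
pose L := l * expR s + (1 - l) * T.
have L1 : 1 < L.
  have : 0 <= (1 - l) * (T - expR s) by rewrite mulr_ge0//; lra.
  by rewrite /L; lra.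
have LT : L < expR t.
  have : 0 < l ^+ 2 * (expR t - expR s) by rewrite mulr_gt0 ?exprn_gt0// subr_gt0.
  by rewrite /L /T expr2; lra.
exists (ln L); split; first by rewrite ln_gt0.
  by rewrite -(expRK t) ltr_ln// posrE; lra.
have tlnT : t < ln T by rewrite -{1}(expRK t) ltr_ln// posrE; lra.
have lnT0 : 0 <= ln T by lra.
have lnL0 : 0 <= ln L by rewrite ln_ge0// ltW.
rewrite dT_coverE; apply: (fin_cover_setU1 _ orbitE).
  split=> [_ -> //|y z -> ->]; apply/dT_le_lnP => //; first exact: ltW.
  by apply: (thompson_eqv_le coneC _ _ (ltW L1));
    rewrite /thompson_eqv ?scale1r ?subrr; try exact: coneIntW;
    split; rewrite -(scale0r (x 0%N)); apply: cone_scale => //; exact: coneIntW.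
rewrite dT_coverE in fs; have := tu _ tlnT; rewrite dT_coverE => {}tu.
apply: (fin_cover_image2 fs tu) => A B [AC As] [BC Bt].
have op_int v w : A v -> B w -> C° (mann_op v w).
  move=> Av Bw; apply: coneInt_add => //.
    by apply: coneInt_scale => //; exact: AC.
  by apply: cone_scale => //; [lra|apply: coneIntW; exact: BC].
split=> [_ [v [_ Av] [w [_ Bw] <-]]|]; first exact: op_int.
move=> _ _ [v [vx Av] [w [wx Bw] <-]] [v' [vx' Av'] [w' [wx' Bw'] <-]].
apply/dT_le_lnP => //; [exact: op_int|exact: op_int|exact: ltW|].
have fx a b : (f @` range x) a -> range x b -> C (K *: a - b).
  by move=> [_ [n _ <-] <-] [m _ <-].
apply: mann_op_eqv => //; [lra|exact: fx|exact: fx| |].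
  by apply/dT_le_thompson_eqv; [..|exact: As] => //; [exact: AC|exact: AC|exact: ltW].
rewrite -(lnK (x := T)) ?posrE//.
by apply/dT_le_thompson_eqv; [..|exact: Bt] => //; exact: BC.
Qed.

End Convergence.

(** By normality, on a norm-bounded set a small Thompson diameter forces a small norm diameter. *)
Lemma dT_cover_norm_cover (R : realType) (V : completeNormedModType R)
    (C A : set V) (M : R) :
  is_closed_cone C -> normal_cone C -> A `<=` C° ->
  (forall x, A x -> `|x| <= M) -> (forall e, 0 < e -> dT_cover C A e) ->
  forall e, 0 < e -> norm_cover A e.
Proof.
move=> coneC normalC AC AM Acov e e0.
have [c c0 cC] := normal_dist_le coneC normalC.
pose N := `|M| + 1; have N0 : 0 < N by rewrite ltr_wpDl.
have ecN : 0 < e / (c * N) by rewrite divr_gt0// mulr_gt0.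
have [|n [S [AS Sd]]] := Acov (ln (1 + e / (c * N))).
  by rewrite ln_gt0// ltrDl.
exists n, (fun i => S i `&` A); split.
  by move=> y Ay; have [i ni Siy] := AS y Ay; exists i.
move=> i ni y z [Sy Ay] [Sz Az]; have [SC Si] := Sd i ni.
have yz : thompson_eqv C (1 + e / (c * N)) y z.
  by apply/dT_le_lnP => //; [exact: SC|exact: SC|rewrite lerDl ltW|exact: Si].
apply: le_trans (cC _ _ _ _ _ yz) _.
- by rewrite lerDl ltW.
- by apply: coneIntW; exact: AC.
have zN : `|z| <= N by have := AM z Az; have := ler_norm M; rewrite /N; lra.
have -> : c * (1 + e / (c * N) - 1) * `|z| = e * (`|z| / N).
  by field; rewrite !gt_eqF.
by rewrite ger_pMr// ler_pdivrMr// mul1r.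
Qed.

(** * Convergence of the averaged iteration *)

Unset Implicit Arguments.

Theorem theorem3p1 (R : realType) (V : completeNormedModType R) (C : set V)
  (f : V -> V) :
  is_closed_cone C -> normal_cone C -> (exists z, C° z) ->
  (forall x, C° x -> C° (f x)) ->
  dT_nonexpansive C f ->
  gamma_condensing C f \/ tau_condensing C f ->
  (exists p, C° p /\ f p = p) ->
  forall (alpha : R), 0 < alpha -> alpha < 1 ->
  forall (x0 : V), C° x0 ->
  forall x : nat -> V, x 0%N = x0 ->
    (forall n, x n.+1 = alpha *: f (x n) + (1 - alpha) *: x n) ->
  exists p, [/\ C° p, f p = p & x @ \oo --> p].
Proof.
move=> coneC normalC _ f_int f_ne cond [p [Ip fp]] a a0 a1 x0 Ix0 x xx0 xS.
have f_eqv b y z : 1 <= b -> C° y -> C° z ->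
    thompson_eqv C b y z -> thompson_eqv C b (f y) (f z).
  move=> b1 Iy Iz /dT_le_lnP yz; apply/dT_le_lnP => //; try exact: f_int.
  exact: le_trans (f_ne _ _ Iy Iz) (yz _ _ _ _).
have {}Ix0 : C° (x 0%N) by rewrite xx0.
have Ix n : C° (x n) by exact: (mann_int coneC f_int a0 a1 Ix0 xS).
have Cx n : C (x n) by exact: coneIntW.
have [K0 K01 xK0] := thompson_eqv_ex coneC Ix0 Ip.
have xp n : thompson_eqv C K0 (x n) p.
  rewrite -(add0n n).
  by apply: (mann_fix_eqv coneC f_int f_eqv a0 a1 Ix0 xS n K01 Ip fp xK0).
have fxp n : thompson_eqv C K0 (f (x n)) p by rewrite -fp; exact: f_eqv.
have K00 : 0 <= K0 by lra.
have K1 : 1 <= K0 * K0 by nra.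
(* Orbit points are compared through [p], which squares the constant. *)
have xK n m : thompson_eqv C (K0 * K0) (x n) (x m).
  by apply: (thompson_eqv_trans coneC (y := p)) => //; exact: thompson_eqv_sym.
have fxK n m : thompson_eqv C (K0 * K0) (f (x n)) (x m).
  by apply: (thompson_eqv_trans coneC (y := p)) => //; exact: thompson_eqv_sym.
have [c c0 cC] := normal_dist_le coneC normalC.
pose M := `|p| + c * (K0 - 1) * `|p| + 1.
have cK0 : 0 <= c * (K0 - 1) * `|p|.
  by rewrite !mulr_ge0//; lra.
have M0 : 0 < M by rewrite /M; have := normr_ge0 p; lra.
have xM n : `|x n| <= M.
  have := cC _ _ _ K01 (coneIntW Ip) (xp n); rewrite -{2}(subrK p (x n)).
  by have := ler_normD (x n - p) p; rewrite /M; lra.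
have xC : range x `<=` C° by move=> _ [n _ <-].
(* Both condensing hypotheses end in norm covers, the second by way of Thompson covers and
   normality. *)
have xcov e : 0 < e -> norm_cover (range x) e.
  case: cond => -[_ cond].
    have [M' M'0 M'c] : exists2 d : R, 0 < d & norm_cover (range x) d.
      exists (2 * M); first by rewrite mulr_gt0.
      rewrite norm_coverE; apply: fin_cover_refl => _ _ [n _ <-] [m _ <-].
      by have := ler_normB (x n) (x m); have := xM n; have := xM m; lra.
    apply: (@condensing_vanish _ (norm_cover (range x)) (norm_cover (f @` range x))).
    + by exists M'.
    + move=> d d' [n [S [xSc Sd]]] dd'; exists n, S; split => // i ni y z Sy Sz.
      exact: le_trans (Sd i ni y z Sy Sz) dd'.
    + by apply: cond => //; exists M => _ [n _ <-].
    + exact: (norm_cover_orbit a0 a1 xS).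
  apply: (dT_cover_norm_cover (M := M) coneC normalC xC).
    by move=> _ [n _ <-].
  have dTx y z : range x y -> range x z -> dT C y z <= ln (K0 * K0).
    by move=> [n _ <-] [m _ <-]; apply/dT_le_lnP.
  have lnK : 0 <= ln (K0 * K0) by rewrite ln_ge0.
  apply: (@condensing_vanish _ (dT_cover C (range x)) (dT_cover C (f @` range x))).
  (* The added 1 makes the diameter positive even if [K0 = 1]. *)
  + exists (ln (K0 * K0) + 1); first by lra.
    rewrite dT_coverE; apply: fin_cover_refl; split => // y z xy xz.
    by apply: le_trans (dTx _ _ xy xz) _; lra.
  + move=> d d' [n [S [xSc Sd]]] dd'; exists n, S; split => // i ni.
    have [SC Sdi] := Sd i ni; split => // y z Sy Sz.
    exact: le_trans (Sdi y z Sy Sz) dd'.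
  + by apply: cond => //; exists (ln (K0 * K0)).
  + apply: (dT_cover_orbit coneC a0 a1 Ix0 xS (K := K0 * K0)); first by lra.
    by move=> n m; exact: (fxK n m).1.
have [q xq] := totally_bounded_cluster xcov.
(* The lower bound [K0^-1 *: p] on the orbit passes to [q] and keeps it in the interior. *)
have qp : C (K0 *: q - p).
  apply: (cone_closed coneC (y := p)) => e e0.
  have /coneIntP[r r0 rC] := Ip.
  have [n _ xnq] := xq (r * e / K0) 0%N (divr_gt0 (mulr_gt0 r0 e0) (lt_le_trans ltr01 K01)).
  have -> : K0 *: q - p + e *: p =
      (K0 *: x n - p) + e *: (p + (K0 / e) *: (q - x n)).
    by field_module; rewrite gt_eqF.
  apply: (cone_add coneC); first exact: (xp n).1.
  apply: (cone_scale coneC); first exact: ltW.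
  apply: rC; rewrite normrZ distrC ger0_norm; last by rewrite divr_ge0// ltW.
  rewrite mulrAC ler_pdivrMr// mulrC -ler_pdivlMr; last by lra.
  exact: ltW.
have Iq : C° q.
  have -> : q = K0^-1 *: (p + (K0 *: q - p)) by field_module; rewrite gt_eqF//; lra.
  by apply: coneInt_scale; [|rewrite invr_gt0; lra|apply: coneInt_add].
have xq_eqv b N : 1 < b -> exists2 n, (N <= n)%N & thompson_eqv C b (x n) q.
  move=> b1; have [|d d0 dC] := thompson_eqv_of_dist coneC Ip (_ : 0 < K0); first by lra.
  have bd : 0 < (b - 1) / d by rewrite divr_gt0// subr_gt0.
  have [n Nn xnq] := xq ((b - 1) / d) N bd; exists n => //.
  have -> : b = 1 + d * ((b - 1) / d) by field; rewrite gt_eqF.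
  by apply: dC (ltW bd) (ltW xnq) => //; exact: (xp n).1.
have Fq : mann_map f a q = q.
  apply: (thompson_eqv1 coneC); apply: (thompson_eqv_closed coneC) => b b1.
  have b0 : 0 < b by lra.
  (* A cube root of [b], one factor for each link of the chain from [mann_map f a q] via [x n.+1]
     and [x n] to [q]. *)
  pose h := expR (ln b / 3).
  have h1 : 1 < h by rewrite expR_gt1 divr_gt0// ln_gt0.
  have h0 : 0 <= h by lra.
  have -> : b = h * (h * h).
    by rewrite -!expRD -{1}(lnK (x := b)) ?posrE//; congr expR; field.
  have [N xN] := mann_asymptotic_regular coneC f_int f_eqv a0 a1 Ix0 xS K1 xK h1.
  have [n Nn xnq] := xq_eqv h N h1.
  apply: (thompson_eqv_trans coneC (y := x n.+1)) => //; first by rewrite mulr_ge0.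
    rewrite xS; apply: (mann_map_eqv coneC f_eqv a0 a1) => //; first exact: ltW.
    exact: thompson_eqv_sym.
  apply: (thompson_eqv_trans coneC (y := x n)) => //.
  by apply: thompson_eqv_sym; exact: xN.
have fq : f q = q.
  have -> : f q = a^-1 *: (mann_map f a q - (1 - a) *: q).
    by rewrite /mann_map; field_module; rewrite gt_eqF.
  by rewrite Fq; field_module; rewrite gt_eqF.
exists q; split => //; apply/cvgrPdist_lt => e e0.
have q1 : 0 < `|q| + 1 by rewrite ltr_wpDl.
have cq : 0 < c * (`|q| + 1) by rewrite mulr_gt0.
(* Makes the normality bound [c * (b - 1) * |q|] smaller than [e]. *)
pose b := 1 + e / (c * (`|q| + 1)).
have b1 : 1 < b by rewrite ltrDl divr_gt0.
have [N _ xNq] := xq_eqv b 0%N b1.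
exists N => // n /= Nn; rewrite distrC -(subnKC Nn).
(* As [q] is fixed, closeness at the single index [N] persists at all later ones. *)
have h := mann_fix_eqv coneC f_int f_eqv a0 a1 Ix0 xS (n - N) (ltW b1) Iq fq xNq.
apply: le_lt_trans (cC _ _ _ (ltW b1) (coneIntW Iq) h) _.
have -> : c * (b - 1) * `|q| = e * `|q| / (`|q| + 1).
  by rewrite /b; field; rewrite !gt_eqF.
by rewrite ltr_pdivrMr// mulrDr mulr1; lra.
Qed.
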